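(* For all positive integers $\Delta$ and $n$ such that $\Delta \equiv 0 \pmod 4$ and $n\equiv 0 \pmod{5(\Delta/2-1)}$, there is a chordal $K_{3,3}$-minor-free graph $G$ with $|V(G)|=n$, $\Delta(G)=\Delta$, and $$\mathrm{cr}(G)=\frac{\Delta n}{40}\Big(1+\frac{2}{\Delta-2}\Big)\,>\, \frac{\Delta n}{40}.$$
   Context: All graphs are undirected, simple and finite. $\Delta(G)$ denotes the maximum degree of $G$. A graph is chordal if every induced cycle is a triangle. A drawing of a graph represents each vertex by a distinct point in the plane and each edge by a simple curve between its endpoints, such that the only vertices an edge intersects are its own endpoints, and no three edges intersect at a common point (except at a common endpoint). A crossing is a point of intersection between two edges other than a common endpoint. The crossing number $\mathrm{cr}(G)$ is the minimum number of crossings in a drawing of $G$ in the plane. *)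

(* Defs.v *)
From mathcomp Require Import all_boot all_order all_algebra.
From mathcomp Require Import all_classical all_reals all_analysis.
Set Implicit Arguments.
Unset Strict Implicit.
Unset Printing Implicit Defensive.
Import Order.TTheory GRing.Theory Num.Theory.
Import numFieldNormedType.Exports.
Local Open Scope ring_scope.

Record sgraph := SGraph {
  vertex :> finType;
  adj : rel vertex;
  adj_sym : symmetric adj;
  adj_irrefl : irreflexive adj }.

Definition edges (G : sgraph) : {set {set G}} :=
  [set e : {set G} | [exists x, exists y, adj x y && (e == [set x; y]%SET)]]%SET.

Definition max_degree (G : sgraph) : nat :=
  (\max_(x : G) #|[pred y | adj x y]|)%N.

Definition induced_cycle (G : sgraph) (c : seq G) : Prop :=
  [/\ (2 < size c)%N, ucycle (@adj G) c &
      forall x y, x \in c -> y \in c -> adj x y -> y = next c x \/ x = next c y].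

Definition chordal (G : sgraph) : Prop :=
  forall c : seq G, induced_cycle c -> size c = 3%N.

Definition connected_in (G : sgraph) (S : {set G}) : Prop :=
  forall x y, x \in S -> y \in S ->
    connect [rel u v | [&& u \in S, v \in S & adj u v]] x y.

(* The sets [phi h] are the branch sets, contracted to the vertices of [H]. *)
Definition minor (H G : sgraph) : Prop :=
  exists phi : H -> {set G},
    [/\ forall h, phi h != finset.set0,
        forall h, connected_in (phi h),
        forall h k, h != k -> [disjoint phi h & phi k] &
        forall h k, adj h k ->
          exists x y, [/\ x \in phi h, y \in phi k & adj x y]].

Definition minor_free (H G : sgraph) : Prop := ~ minor H G.

Definition K33_adj : rel (bool * 'I_3) := fun x y => x.1 != y.1.

Lemma K33_adj_sym : symmetric K33_adj.
Proof. by move=> x y; rewrite /K33_adj eq_sym. Qed.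

Lemma K33_adj_irrefl : irreflexive K33_adj.
Proof. by move=> x; rewrite /K33_adj eqxx. Qed.

Definition K33 : sgraph := SGraph K33_adj_sym K33_adj_irrefl.

Local Open Scope classical_set_scope.

(* [pos v] is the point of [v]; [curve e], restricted to [[0, 1]], is the
   curve of the edge [e], traversed in either direction. The values of [curve]
   outside [edges G] are irrelevant. *)
Record drawing (R : realType) (G : sgraph) := Drawing {
  pos : G -> R * R;
  curve : {set G} -> R -> R * R;
  pos_inj : injective pos;
  curve_continuous : forall e, e \in edges G ->
    {within `[0, 1], continuous (curve e)};
  curve_simple : forall e, e \in edges G ->
    {in `[0, 1]%R &, injective (curve e)};
  curve_ends : forall e, e \in edges G ->
    [set curve e 0; curve e 1] = pos @` [set` e];
  curve_vertex : forall e v, e \in edges G ->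
    (curve e @` `[0, 1]) (pos v) -> v \in e;
  curve_triple : forall e f g p,
    e \in edges G -> f \in edges G -> g \in edges G ->
    e != f -> e != g -> f != g ->
    (curve e @` `[0, 1]) p -> (curve f @` `[0, 1]) p ->
    (curve g @` `[0, 1]) p ->
    exists v, [/\ v \in e, v \in f, v \in g & p = pos v] }.

(* By [curve_vertex] and [curve_triple], each of these points lies on exactly
   two edges and is interior to both, so counting the points is counting
   crossings. *)
Definition crossings (R : realType) (G : sgraph) (D : drawing R G) :
    set (R * R) :=
  [set p | exists e f, [/\ e \in edges G, f \in edges G, e != f,
    (curve D e @` `[0, 1] `&` curve D f @` `[0, 1]) p &
    ~ exists v, [/\ v \in e, v \in f & p = pos D v]]].

Definition drawable_with (R : realType) (G : sgraph) (k : nat) : Prop :=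
  exists D : drawing R G, (crossings D #= `I_k)%card.

(* The minimum exists because every graph has a drawing with finitely many
   crossings, so the default value [0] of [xget] is never used. Drawings with
   infinitely many crossings do not affect the minimum. *)
Definition crossing_number (R : realType) (G : sgraph) : nat :=
  xget 0%N [set k | drawable_with R G k /\
                    forall l, drawable_with R G l -> (k <= l)%N].

(* Main.v *)
Require Import Defs.
From mathcomp Require Import all_boot all_order all_algebra.
From mathcomp Require Import all_classical all_reals all_analysis.
From mathcomp Require Import lra ring zify.
Import Order.TTheory GRing.Theory Num.Theory numFieldNormedType.Exports.
Local Open Scope ring_scope.

(** Each of the [k] components is a [K5] in which every edge [uv] is accompanied
by [m] paths of length two from [u] to [v], where [Delta = 4 (m + 1)]; so every
edge of [K5] becomes a bundle of [m + 1] paths.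

Lower bound. Choosing one path in each of the ten bundles gives a subdivided
[K5], and in every drawing two paths belonging to disjoint edges of [K5] must
meet. A crossing determines the component and two of the ten choices, so it
serves at most [(m + 1) ^ 8] of the [k (m + 1) ^ 10] choices, and there are at
least [k (m + 1) ^ 2] crossings. The topological input is the van Kampen
obstruction modulo 2. If the curves [alpha] and [beta] are disjoint, then
[alpha s - beta t] never vanishes on the unit square, so along the boundary of
the square it crosses any ray from the origin an even number of times. This
relates the number of times [alpha] passes to the right of the ends of [beta],
the same number with the curves exchanged, and the relative heights of the four
ends. Summed over the 15 disjoint pairs of edges of [K5], the passing numbers
cancel while the height terms have odd sum.

Upper bound. Draw [K5] with a single crossing and replace each edge by a thin
bundle of parabolic arcs, so that only two bundles cross. *)

(** * Parity of the crossings with a ray *)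

Section Winding.
Context {R : realType}.
Implicit Types z : R * R.

Definition half_plane (h : bool * bool) z :=
  0 < (-1) ^+ h.1 * (if h.2 then z.1 else z.2).

(* The positive horizontal axis counts as upper, so that exactly one of [z] and
   [- z] is upper whenever [z] is nonzero. *)
Definition upper z := (0 < z.2) || ((z.2 == 0) && (0 < z.1)).

(* Detects a crossing of the positive horizontal axis by a short step from [z]
   to [z'], where short means that both lie in one of the four [half_plane]s. *)
Definition ray_crossed z z' := (upper z (+) upper z') && (0 < z.1).

Lemma upperN z : z != 0 -> upper (- z) = ~~ upper z.
Proof.
case: z => x y; rewrite /upper xpair_eqE /= !oppr_gt0 oppr_eq0.
by case: (ltgtP y 0); case: (ltgtP x 0).
Qed.

Lemma half_plane_neq0 h z : half_plane h z -> z != 0.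
Proof. by apply: contraTneq => ->; rewrite /half_plane if_same mulr0 ltxx. Qed.

(** A short step that changes [upper] crosses exactly one of the positive and negative horizontal
    half-axes, and negation exchanges the two. *)
Lemma ray_crossedN h z z' : half_plane h z -> half_plane h z' ->
  ray_crossed (- z) (- z') = ray_crossed z z' (+) upper z (+) upper z'.
Proof.
move=> hz hz'; rewrite /ray_crossed !upperN ?(half_plane_neq0 _ _ hz) ?(half_plane_neq0 _ _ hz') //.
case: z z' hz hz' => x y [x' y']; rewrite /half_plane /upper /= oppr_gt0.
case: h => -[] []; rewrite ?expr0 ?expr1 /=;
case: (ltgtP y 0); case: (ltgtP y' 0) => //=; case: (ltgtP x 0); case: (ltgtP x' 0) => //=; lra.
Qed.

(** Within one half-plane the crossings form a coboundary: for positive abscissae [ray_crossed] is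
    the change of [upper], and in the other three half-planes it vanishes. *)
Lemma ray_crossed_cocycle h z1 z2 z3 z4 :
  half_plane h z1 -> half_plane h z2 -> half_plane h z3 -> half_plane h z4 ->
  ray_crossed z1 z2 (+) ray_crossed z3 z4 = ray_crossed z1 z3 (+) ray_crossed z2 z4.
Proof.
case: z1 z2 z3 z4 => x1 y1 [x2 y2] [x3 y3] [x4 y4].
rewrite /half_plane /ray_crossed /upper.
case: h => -[] []; rewrite /= ?expr0 ?expr1 ?mul1r ?mulN1r ?oppr_gt0 => h1 h2 h3 h4.
- by rewrite !(ltNge 0 x1, ltNge 0 x2, ltNge 0 x3, ltNge 0 x4) !ltW //= !andbF.
- by rewrite !(ltNge 0 y1, ltNge 0 y2, ltNge 0 y3, ltNge 0 y4) !ltW ?lt_eqF.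
- rewrite h1 h2 h3 h4 !andbT.
  by move: (_ || _) => [] ; move: (_ || _) => [] ; move: (_ || _) => [] ; move: (_ || _) => [].
- by rewrite h1 h2 h3 h4.
Qed.

End Winding.

Section Grid.
Context {R : realType}.
Implicit Types (alpha beta : nat -> R * R) (v : R * R).

Definition turning n alpha v : bool :=
  \big[addb/false]_(i < n) ray_crossed (alpha i - v) (alpha i.+1 - v).

Definition cell_in_half_plane alpha beta i j := exists h,
  [/\ half_plane h (alpha i - beta j), half_plane h (alpha i.+1 - beta j),
      half_plane h (alpha i - beta j.+1) &
      half_plane h (alpha i.+1 - beta j.+1)].

Lemma telescope_addb (f : nat -> bool) n :
  \big[addb/false]_(i < n) (f i (+) f i.+1) = f 0%N (+) f n.
Proof.
elim: n => [|n IH]; first by rewrite big_ord0 addbb.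
by rewrite big_ord_recr /= IH -!addbA [f n (+) _]addbA addbb.
Qed.

(* Summing [ray_crossed_cocycle] over the cells of the grid [alpha i - beta j]
   leaves the boundary. On two of its sides the curve [beta] enters with a minus
   sign, and [ray_crossedN] produces the right-hand side. *)
Lemma grid_parity n alpha beta :
  (forall i j, (i <= n)%N -> (j <= n)%N -> cell_in_half_plane alpha beta i j) ->
  turning n.+1 alpha (beta 0%N) (+) turning n.+1 alpha (beta n.+1) (+)
    (turning n.+1 beta (alpha 0%N) (+) turning n.+1 beta (alpha n.+1)) =
  upper (alpha 0%N - beta 0%N) (+) upper (alpha 0%N - beta n.+1) (+)
    (upper (alpha n.+1 - beta 0%N) (+) upper (alpha n.+1 - beta n.+1)).
Proof.
move=> cell; pose z i j := alpha i - beta j.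
pose V i := \big[addb/false]_(j < n.+1) ray_crossed (z i j) (z i j.+1).
(* Here [beta] enters with a minus sign; the correction terms telescope along the side. *)
have turningV i : (i <= n.+1)%N ->
    turning n.+1 beta (alpha i) = V i (+) (upper (z i 0%N) (+) upper (z i n.+1)).
  move=> le_i; rewrite -(telescope_addb (fun j => upper (z i j))) -big_split /=.
  apply: eq_bigr => j _.
  have [h [hz hz']] :
      exists h, half_plane h (z i j) /\ half_plane h (z i j.+1).
    case: (ltnP i n.+1) le_i => [lt_i _|ge_i le_i].
      by have [h []] := cell i j lt_i (ltn_ord j); exists h.
    have -> : i = n.+1 by apply/eqP; rewrite eqn_leq le_i.
    by have [h []] := cell n j (leqnn n) (ltn_ord j); exists h.
  by rewrite -[beta j - _]opprB -[beta j.+1 - _]opprB (ray_crossedN _ _ _ hz hz') addbA.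
have strip i m : (i <= n)%N -> (m <= n.+1)%N ->
    ray_crossed (z i 0%N) (z i.+1 0%N) (+) ray_crossed (z i m) (z i.+1 m) =
    \big[addb/false]_(j < m) (ray_crossed (z i j) (z i j.+1) (+)
                              ray_crossed (z i.+1 j) (z i.+1 j.+1)).
  move=> le_i; elim: m => [|m IH] lt_m; first by rewrite big_ord0 addbb.
  have [h [h1 h2 h3 h4]] := cell i m le_i lt_m.
  rewrite big_ord_recr /= -IH ?(ltnW lt_m) // -(ray_crossed_cocycle _ _ _ _ _ h1 h2 h3 h4).
  by do 3!case: (ray_crossed _ _).
have -> : turning n.+1 alpha (beta 0%N) (+) turning n.+1 alpha (beta n.+1) =
    V 0%N (+) V n.+1.
  rewrite -telescope_addb /turning -big_split /=; apply: eq_bigr => i _.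
  by rewrite (strip i n.+1) ?leq_ord // /V -big_split.
rewrite !turningV // /z.
by case: (V _); case: (V _); case: upper; case: upper; case: upper; case: upper.
Qed.


Local Open Scope classical_set_scope.

(** By continuity the difference locally keeps the sign of a nonzero coordinate; compactness of the
    square makes one mesh serve everywhere. *)
Lemma near_half_plane (alpha beta : R -> R * R) :
  {within `[0, 1], continuous alpha} -> {within `[0, 1], continuous beta} ->
  (forall s t, `[0, 1] s -> `[0, 1] t -> alpha s <> beta t) ->
  \forall n \near \oo, forall s t, `[0, 1] s -> `[0, 1] t -> exists h,
    forall s' t', `[0, 1] s' -> `[0, 1] t' ->
      `|s - s'| <= n.+1%:R^-1 -> `|t - t'| <= n.+1%:R^-1 ->
      half_plane h (alpha s' - beta t').
Proof.
move=> /subspace_continuousP ca /subspace_continuousP cb disj.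
pose P n (x : R * R) := exists h, forall s' t' : R, `[0, 1] s' -> `[0, 1] t' ->
  `|x.1 - s'| <= n.+1%:R^-1 -> `|x.2 - t'| <= n.+1%:R^-1 ->
  half_plane h (alpha s' - beta t').
have cpt : compact (`[0, 1]%classic `*` `[0, 1]%classic : set (R * R)).
  by apply: compact_setX; exact: segment_compact.
have := (compact_near_coveringP _).1 cpt nat \oo P _.
move=> /(_ _) cov.
have {cov} : \forall n \near \oo,
    `[0, 1]%classic `*` `[0, 1]%classic `<=` P n.
  apply: cov => -[s0 t0] [/= s0I t0I].
  have [h h0] : exists h, half_plane h (alpha s0 - beta t0).
    have : alpha s0 - beta t0 != 0 by rewrite subr_eq0; apply/eqP/disj.
    case: (alpha s0 - beta t0) => x y; rewrite xpair_eqE negb_and /half_plane /=.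
    case: (ltgtP x 0) => [x0 _|x0 _|_].
    - by exists (true, true); rewrite expr1 mulN1r oppr_gt0.
    - by exists (false, true); rewrite expr0 mul1r.
    case: (ltgtP y 0) => // y0 _.
    - by exists (true, false); rewrite expr1 mulN1r oppr_gt0.
    - by exists (false, false); rewrite expr0 mul1r.
  pose g := (-1) ^+ h.1 * (if h.2 then (alpha s0 - beta t0).1 else (alpha s0 - beta t0).2).
  rewrite /half_plane -/g in h0.
  (* If each curve moves by less than [g / 2], the chosen coordinate keeps its sign. *)
  have g2 : 0 < g / 2 by rewrite divr_gt0.
  have [/= e1 e10 he1] := (nbhs_ballP _ _).1 (ca s0 s0I _ (near_ball (alpha s0) (g / 2) g2)).
  have [/= e2 e20 he2] := (nbhs_ballP _ _).1 (cb t0 t0I _ (near_ball (beta t0) (g / 2) g2)).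
  (* Half of the radius is for moving [x] away from [(s0, t0)], half for moving [s'] and [t'] away
     from [x]. *)
  pose e := Num.min e1 e2 / 2.
  have e0 : 0 < e by rewrite divr_gt0 // lt_min e10.
  have [ee1 ee2] : e + e <= e1 /\ e + e <= e2.
    by rewrite /e -splitr !ge_min !lexx orbT.
  near=> x n; exists h => s' t' s'I t'I xs' xt'.
  have ne : n.+1%:R^-1 < e by near: n; exact: (near_infty_natSinv_lt (PosNum e0)).
  have [bx1 bx2] : ball (s0, t0) e x by near: x; exact: (nbhsx_ballx (s0, t0) e e0).
  have {}he1 : ball (alpha s0) (g / 2) (alpha s').
    apply: he1 => //; rewrite -ball_normE /=; apply: lt_le_trans ee1.
    rewrite -ball_normE /= in bx1.
    rewrite -(subrKA x.1) (le_lt_trans (ler_normD _ _)) // ltrD //.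
    exact: le_lt_trans ne.
  have {}he2 : ball (beta t0) (g / 2) (beta t').
    apply: he2 => //; rewrite -ball_normE /=; apply: lt_le_trans ee2.
    rewrite -ball_normE /= in bx2.
    rewrite -(subrKA x.2) (le_lt_trans (ler_normD _ _)) // ltrD //.
    exact: le_lt_trans ne.
  move: he1 he2 => [a1 a2] [b1 b2].
  move: a1 a2 b1 b2 h0 g2; rewrite /g -!ball_normE /= /half_plane.
  case: h @g => -[] [] _ /=; rewrite ?expr1 ?expr0;
  by move=> /ltr_normlP[? ?] /ltr_normlP[? ?] /ltr_normlP[? ?] /ltr_normlP[? ?]; lra.
apply: filterS => n sub s t sI tI; exact: (sub (s, t)).
Unshelve. all: end_near. Qed.

End Grid.

(** * The mod 2 van Kampen obstruction for [K5] *)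

(* The edges of [K5] are numbered 0 to 9 in lexicographic order. *)
Definition K5_src (e : 'I_10) : 'I_5 :=
  inord (nth 0%N [:: 0; 0; 0; 0; 1; 1; 1; 2; 2; 3]%N e).
Definition K5_tgt (e : 'I_10) : 'I_5 :=
  inord (nth 0%N [:: 1; 2; 3; 4; 2; 3; 4; 3; 4; 4]%N e).

Definition K5_disjoint (e f : 'I_10) :=
  [&& K5_src e != K5_src f, K5_src e != K5_tgt f,
      K5_tgt e != K5_src f & K5_tgt e != K5_tgt f].


(* Curves from [s] to [t] and from [s'] to [t'] satisfying the parity relation of
   [grid_parity]: [T v] counts modulo 2 how often the first passes to the right of
   [v], and [U v w] says that [v] is above [w]. *)
Definition linked {P : Type} (U : P -> P -> bool) (T : P -> bool) (s t : P)
    (T' : P -> bool) (s' t' : P) : Prop :=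
  (T s' (+) T t') (+) (T' s (+) T' t) =
  (U s s' (+) U s t') (+) (U t s' (+) U t t').

(** The contributions of the intermediate point [w] occur twice and cancel modulo 2, so the relation
    passes from the two halves of a path to the whole path. *)
Lemma linked_catl {P : Type} (U : P -> P -> bool) T1 T2 s w t T' s' t' :
  linked U T1 s w T' s' t' -> linked U T2 w t T' s' t' ->
  linked U (fun v => T1 v (+) T2 v) s t T' s' t'.
Proof.
rewrite /linked (addbACA (T1 s') (T2 s')).
move: (T1 s' (+) T1 t') (T2 s' (+) T2 t') (T' s) (T' w) (T' t).
move: (U s s' (+) U s t') (U w s' (+) U w t') (U t s' (+) U t t').
by do 8 case.
Qed.

Lemma linked_catr {P : Type} (U : P -> P -> bool) T s t T1 T2 s' w t' :
  linked U T s t T1 s' w -> linked U T s t T2 w t' ->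
  linked U T s t (fun v => T1 v (+) T2 v) s' t'.
Proof.
rewrite /linked (addbACA (U s s') (U s w)) (addbACA (U s w) (U s t')).
rewrite (addbACA (U s s') (U s t')) (addbACA (T1 s) (T2 s)).
move: (T1 s (+) T1 t) (T2 s (+) T2 t) (T s') (T w) (T t').
move: (U s s' (+) U t s') (U s w (+) U t w) (U s t' (+) U t t').
by do 8 case.
Qed.

Lemma linked_swapl {P : Type} (U : P -> P -> bool) T s t T' s' t' :
  linked U T s t T' s' t' -> linked U T t s T' s' t'.
Proof. by rewrite /linked (addbC (T' s)) (addbC (U s s' (+) _)). Qed.

Lemma linked_swapr {P : Type} (U : P -> P -> bool) T s t T' s' t' :
  linked U T s t T' s' t' -> linked U T s t T' t' s'.
Proof. by rewrite /linked (addbC (T s')) (addbC (U s s')) (addbC (U t s')). Qed.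

Lemma linkedP {P : Type} (U : P -> P -> bool) T s t T' s' t' :
  linked U T s t T' s' t' -> exists y : nat,
    (T s' + T t' + T' s + T' t + U s s' + U s t' + U t s' + U t t' = y + y)%N.
Proof.
rewrite /linked.
move: (T s') (T t') (T' s) (T' t) (U s s') (U s t') (U t s') (U t t').
by do 8 case; move=> //= _; by [exists 0%N | exists 1%N | exists 2%N | exists 3%N | exists 4%N].
Qed.

(** In the sum of the fifteen relations each [T e v] occurs twice, as two of the edges disjoint from
    [e] end at [v]. Each pair of vertices is compared six times. On four given vertices, the three
    disjoint pairs of edges have 0, 1 and 2 comparisons in reversed order; the five quadruples thus
    give 15 reversals, so the height terms have odd sum. *)
Lemma K5_not_linked (U : 'I_5 -> 'I_5 -> bool) (T : 'I_10 -> 'I_5 -> bool) :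
  (forall i j, i != j -> U j i = ~~ U i j) ->
  ~ forall e f, K5_disjoint e f ->
      linked U (T e) (K5_src e) (K5_tgt e) (T f) (K5_src f) (K5_tgt f).
Proof.
move=> UN linkT.
pose e i : 'I_10 := inord i; pose v i : 'I_5 := inord i.
have L i j : (i < 10)%N -> (j < 10)%N -> K5_disjoint (e i) (e j) ->
  let s := nth 0%N [:: 0; 0; 0; 0; 1; 1; 1; 2; 2; 3]%N in
  let t := nth 0%N [:: 1; 2; 3; 4; 2; 3; 4; 3; 4; 4]%N in
  linked U (T (e i)) (v (s i)) (v (t i)) (T (e j)) (v (s j)) (v (t j)).
  by move=> ? ? /linkT; rewrite /K5_src /K5_tgt /e !inordK.
have D i j : (i < 10)%N -> (j < 10)%N -> 
  let s := nth 0%N [:: 0; 0; 0; 0; 1; 1; 1; 2; 2; 3]%N in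
  let t := nth 0%N [:: 1; 2; 3; 4; 2; 3; 4; 3; 4; 4]%N in
  [&& s i != s j, s i != t j, t i != s j & t i != t j] -> K5_disjoint (e i) (e j).
  move=> ? ? s t st; rewrite /K5_disjoint /K5_src /K5_tgt /e !inordK //.
  have sP k : (s k < 5)%N.
    by rewrite /s; case: k => [|[|[|[|[|[|[|[|[|[|k]]]]]]]]]] //=; rewrite nth_nil.
  have tP k : (t k < 5)%N.
    by rewrite /t; case: k => [|[|[|[|[|[|[|[|[|[|k]]]]]]]]]] //=; rewrite nth_nil.
  by rewrite -!(inj_eq val_inj) /= !inordK.
have U' i j : (i < j < 5)%N -> (U (v i) (v j) + U (v j) (v i) = 1)%N.
  move=> /andP[ij j5]; rewrite (UN (v i)); first by case: (U _ _).
  by rewrite -(inj_eq val_inj) /= !inordK ?(ltn_trans ij) // ltn_eqF.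
have L' i j ilt jlt st := linkedP _ _ _ _ _ _ _ (L i j ilt jlt (D i j ilt jlt st)).
have [y0 h0] := L' 0 7 isT isT isT.
have [y1 h1] := L' 0 8 isT isT isT.
have [y2 h2] := L' 0 9 isT isT isT.
have [y3 h3] := L' 1 5 isT isT isT.
have [y4 h4] := L' 1 6 isT isT isT.
have [y5 h5] := L' 1 9 isT isT isT.
have [y6 h6] := L' 2 4 isT isT isT.
have [y7 h7] := L' 2 6 isT isT isT.
have [y8 h8] := L' 2 8 isT isT isT.
have [y9 h9] := L' 3 4 isT isT isT.
have [z0 k0] := L' 3 5 isT isT isT.
have [z1 k1] := L' 3 7 isT isT isT.
have [z2 k2] := L' 4 9 isT isT isT.
have [z3 k3] := L' 5 8 isT isT isT.
have [z4 k4] := L' 6 7 isT isT isT.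
have u01 := U' 0 1 isT; have u02 := U' 0 2 isT; have u03 := U' 0 3 isT.
have u04 := U' 0 4 isT; have u12 := U' 1 2 isT; have u13 := U' 1 3 isT.
have u14 := U' 1 4 isT; have u23 := U' 2 3 isT; have u24 := U' 2 4 isT.
have u34 := U' 3 4 isT.
move: h0 h1 h2 h3 h4 h5 h6 h7 h8 h9 k0 k1 k2 k3 k4 u01 u02 u03 u04 u12 u13 u14 u23 u24 u34 => /=.
clear -UN.
do ![match goal with |- context [nat_of_bool ?b] => move: (nat_of_bool b) => ? end].
lia.
Qed.

(** * The bundled [K5] *)

Lemma K5_srcE e : K5_src e = nth 0%N [:: 0; 0; 0; 0; 1; 1; 1; 2; 2; 3]%N e :> nat.
Proof. by rewrite inordK //; case: e => [[|[|[|[|[|[|[|[|[|[|]]]]]]]]]]]. Qed.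

Lemma K5_tgtE e : K5_tgt e = nth 0%N [:: 1; 2; 3; 4; 2; 3; 4; 3; 4; 4]%N e :> nat.
Proof. by rewrite inordK //; case: e => [[|[|[|[|[|[|[|[|[|[|]]]]]]]]]]]. Qed.

Lemma K5_src_lt_tgt e : (K5_src e < K5_tgt e)%N.
Proof. by rewrite K5_srcE K5_tgtE; case: e => [[|[|[|[|[|[|[|[|[|[|]]]]]]]]]]]. Qed.

Lemma K5_src_neq_tgt e : K5_src e != K5_tgt e.
Proof. by rewrite -(inj_eq val_inj) ltn_eqF // K5_src_lt_tgt. Qed.

Lemma K5_ends_inj e f : K5_src e = K5_src f -> K5_tgt e = K5_tgt f -> e = f.
Proof.
move=> /(congr1 val) /= + /(congr1 val) /=; rewrite !K5_srcE !K5_tgtE => s t.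
apply: val_inj => /=; move: s t.
by case: e => [[|[|[|[|[|[|[|[|[|[|]]]]]]]]]]] //= _; case: f => [[|[|[|[|[|[|[|[|[|[|]]]]]]]]]]].
Qed.

Lemma K5_complete (i j : 'I_5) : (i < j)%N -> exists e, K5_src e = i /\ K5_tgt e = j.
Proof.
pose l := [:: (0, 1); (0, 2); (0, 3); (0, 4); (1, 2); (1, 3); (1, 4); (2, 3); (2, 4); (3, 4)]%N.
move=> ij; exists (inord (index (i : nat, j : nat) l)).
split; apply/val_inj; rewrite /= ?K5_srcE ?K5_tgtE;
case: i ij => [[|[|[|[|[|i]]]]] ?] //; case: j => [[|[|[|[|[|j]]]]] ?] //= _;
by rewrite inordK.
Qed.

Lemma set2_eq (T : finType) (a b c d : T) :
  [set a; b]%SET = [set c; d]%SET -> a = c /\ b = d \/ a = d /\ b = c.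
Proof.
move=> eqs; have := set21 c d; have := set22 c d; have := set21 a b; have := set22 a b.
rewrite {1 2}eqs -{3 4}eqs !inE => /orP[]/eqP-> /orP[]/eqP->; auto.
  by rewrite !orbb => /eqP -> _; auto.
by rewrite !orbb => _ /eqP ->; auto.
Qed.

Section BundledK5Graph.
Context (k m : nat).

Definition K5_incident (e : 'I_10) (i : 'I_5) :=
  (i == K5_src e) || (i == K5_tgt e).

Definition bundled_vertex : finType := ('I_k * ('I_5 + 'I_10 * 'I_m))%type.

Definition bundled_adj : rel bundled_vertex := fun x y =>
  (x.1 == y.1) && match x.2, y.2 with
  | inl i, inl j => i != j
  | inl i, inr p | inr p, inl i => K5_incident p.1 i
  | inr _, inr _ => false
  end.

Lemma bundled_adj_sym : symmetric bundled_adj.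
Proof.
move=> [c [i|p]] [d [j|q]]; rewrite /bundled_adj /= [c == d]eq_sym //.
by rewrite [j == i]eq_sym.
Qed.

Lemma bundled_adj_irrefl : irreflexive bundled_adj.
Proof. by move=> [c [i|p]]; rewrite /bundled_adj /= !eqxx. Qed.

Definition bundled_K5 := SGraph bundled_adj_sym bundled_adj_irrefl.

(* The edges of the graph: the third component is [None] for the edge of [K5]
   itself, and otherwise selects one of the halves of a path of length two. *)
Definition bundle_arc : finType := ('I_k * ('I_10 * option ('I_m * bool)))%type.

(** [false] marks the half from the source to the middle vertex, [true] the half from there to the
    target. *)
Definition arc_src (r : bundle_arc) : bundled_K5 :=
  (r.1, if r.2.2 is Some (a, true) then inr (r.2.1, a) else inl (K5_src r.2.1)).

Definition arc_tgt (r : bundle_arc) : bundled_K5 :=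
  (r.1, if r.2.2 is Some (a, false) then inr (r.2.1, a) else inl (K5_tgt r.2.1)).

Definition arc_ends (r : bundle_arc) : {set bundled_K5} := [set arc_src r; arc_tgt r]%SET.

Definition arc_path (r : bundle_arc) : 'I_k * 'I_10 * option 'I_m :=
  (r.1, r.2.1, omap fst r.2.2).

Lemma arc_src_neq_tgt r : arc_src r != arc_tgt r.
Proof.
case: r => c [e [[a []]|]]; apply/eqP => // -[] /eqP.
by rewrite (negPf (K5_src_neq_tgt e)).
Qed.

(** The source of an edge of [K5] precedes its target, so the ends can match only in the same
    orientation. *)
Lemma arc_ends_inj : injective arc_ends.
Proof.
move=> r r' /set2_eq [].
  case: r r' => c [e [[a []]|]] [c' [e' [[a' []]|]]];
    rewrite /arc_src /arc_tgt /= => -[] // [] // -> + [] //.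
  - by move=> -> -> _.
  - by move=> _ -> ->.
  - by move=> /K5_ends_inj eqe /eqe ->.
case: r r' => c [e [[a []]|]] [c' [e' [[a' []]|]]];
  rewrite /arc_src /arc_tgt /= => -[] // [] // -> + [] //.
- by move=> -> _ [] /esym/eqP; rewrite (negPf (K5_src_neq_tgt e')).
- by move=> /[swap] -> /eqP; rewrite (negPf (K5_src_neq_tgt e')).
- by move=> s t; have := K5_src_lt_tgt e; rewrite s t ltnNge ltnW ?K5_src_lt_tgt.
Qed.

Lemma edges_bundledP (x : {set bundled_K5}) :
  reflect (exists r, x = arc_ends r) (x \in edges bundled_K5).
Proof.
apply: (iffP idP); last first.
  move=> [r ->]; rewrite inE; apply/existsP; exists (arc_src r).
  apply/existsP; exists (arc_tgt r); rewrite eqxx andbT.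
  case: r => c [e [[a []]|]]; rewrite /arc_src /arc_tgt /= /bundled_adj;
    rewrite /K5_incident /= !eqxx ?orbT //=.
  exact: K5_src_neq_tgt.
rewrite inE => /existsP[[c u]] /existsP[[d v]] /andP[/andP[/= /eqP <- uv] /eqP ->].
suff [r [eq_r | eq_r]] : exists r : bundle_arc, [set (c, u); (c, v)]%SET = arc_ends r \/
    [set (c, v); (c, u)]%SET = arc_ends r.
- by exists r; rewrite -eq_r.
- by exists r; rewrite -eq_r finset.setUC.
case: u v uv => [i|[e a]] [j|[f b]] //.
- rewrite -(inj_eq val_inj) neq_ltn => /orP[] /K5_complete[e [<- <-]].
    by exists (c, (e, None)); left.
  by exists (c, (e, None)); right.
- move=> /orP[] /eqP ->; first by exists (c, (f, Some (b, false))); left.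
  by exists (c, (f, Some (b, true))); right.
- move=> /orP[] /eqP ->; first by exists (c, (e, Some (a, false))); right.
  by exists (c, (e, Some (a, true))); left.
Qed.

Lemma arc_ends_edge r : arc_ends r \in edges bundled_K5.
Proof. by apply/edges_bundledP; exists r. Qed.

Lemma arc_ends_disjoint r r' : r.1 = r'.1 -> K5_disjoint r.2.1 r'.2.1 ->
  [disjoint arc_ends r & arc_ends r'].
Proof.
move=> eqc /and4P[ss st ts tt].
have ef : r.2.1 != r'.2.1 by apply: contraNneq ss => ->.
rewrite finset.disjoints_subset; apply/fintype.subsetP => x.
rewrite !inE negb_or /arc_src /arc_tgt eqc.
case: r r' ss st ts tt ef {eqc} => c [e o] [c' [f o']] /= ss st ts tt ef.
by move=> /orP[] /eqP -> /=; apply/andP; split; apply/eqP;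
  case: o => [[a []]|]; case: o' => [[a' []]|] // -[] /eqP;
  by rewrite ?(negPf ss) ?(negPf st) ?(negPf ts) ?(negPf tt) ?(negPf ef).
Qed.

End BundledK5Graph.

Arguments arc_src {k m} r.
Arguments arc_tgt {k m} r.
Arguments arc_ends {k m} r.
Arguments arc_path {k m} r.
Arguments arc_src_neq_tgt {k m} r.
Arguments arc_ends_inj {k m}.
Arguments edges_bundledP {k m x}.
Arguments arc_ends_edge {k m} r.
Arguments arc_ends_disjoint {k m} r r'.

(** * Every drawing has many crossings *)

(** Replacing the two prescribed values by an arbitrary pair of values injects the product into the
    set of all functions. *)
Lemma card_ffun_fix2 (E O : finType) (e f : E) (a b : O) : e != f ->
  (#|[set phi : {ffun E -> O} | (phi e == a) && (phi f == b)]%SET| * #|O| ^ 2 <=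
   #|O| ^ #|E|)%N.
Proof.
move=> ef; set S := [set phi | _]%SET.
pose g (x : {ffun E -> O} * (O * O)) : {ffun E -> O} :=
  [ffun z => if z == e then x.2.1 else if z == f then x.2.2 else x.1 z].
have -> : (#|S| * #|O| ^ 2 = #|finset.setX S [set: O * O]|)%N.
  by rewrite cardsX cardsT card_prod.
rewrite -card_ffun -(card_in_imset (f := g)) ?max_card //.
move=> [phi [x y]] [psi [x' y']]; rewrite !inE !andbT /=.
move=> /andP[/eqP pe /eqP pf] /andP[/eqP qe /eqP qf] /ffunP eq_g.
have := eq_g e; have := eq_g f; rewrite !ffunE !eqxx eq_sym (negPf ef) /= => -> ->.
congr (_, _); apply/ffunP => z; have := eq_g z; rewrite !ffunE /=.
by have [->|_] := eqVneq z e; [rewrite pe qe | have [->|_] := eqVneq z f; rewrite ?pf ?qf].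
Qed.

Section LowerBound.
Local Open Scope classical_set_scope.
Context {R : realType}.

Definition above (p q : R * R) := upper (p - q).

Definition curve_turning n (alpha : R -> R * R) :=
  turning n.+1 (fun i => alpha (i%:R / n.+1%:R)).

(** For a fine enough mesh every cell of the sampled grid lies in one half-plane, so [grid_parity]
    applies. *)
Lemma near_linked (alpha beta : R -> R * R) :
  {within `[0, 1], continuous alpha} -> {within `[0, 1], continuous beta} ->
  (forall s t, `[0, 1] s -> `[0, 1] t -> alpha s <> beta t) ->
  \forall n \near \oo, linked above
    (curve_turning n alpha) (alpha 0) (alpha 1)
    (curve_turning n beta) (beta 0) (beta 1).
Proof.
move=> ca cb disj; have := near_half_plane _ _ ca cb disj.
apply: filterS => n sep; rewrite /linked /above.
have in01 i : (i <= n.+1)%N -> `[0%R, 1%R]%classic (i%:R / n.+1%:R : R).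
  by move=> le_i; rewrite /= in_itv /= divr_ge0 // ler_pdivrMr // mul1r ler_nat le_i.
have := grid_parity n (fun i => alpha (i%:R / n.+1%:R)) (fun i => beta (i%:R / n.+1%:R)).
rewrite mul0r divff ?pnatr_eq0 //; apply => i j le_i le_j.
have [h hh] := sep _ _ (in01 i (leqW le_i)) (in01 j (leqW le_j)).
have step0 (x : R) : `|x - x| <= n.+1%:R^-1 by rewrite subrr normr0 invr_ge0.
have step1 p : `|p%:R / n.+1%:R - p.+1%:R / n.+1%:R| <= n.+1%:R^-1 :> R.
  rewrite -mulrBl -natr1 opprD addrA subrr sub0r mulN1r normrN.
  by rewrite ger0_norm ?invr_ge0 ?lexx ?ler0n.
by exists h; split; apply: hh => //; (exact: in01 || exact/in01/leqW).
Qed.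

Context {k m : nat} (D : drawing R (bundled_K5 k m)).

Definition arc_curve (r : bundle_arc k m) := curve D (arc_ends r).

(** A curve may run from target to source, but [linked] does not depend on the direction. *)
Lemma near_linked_arcs (r r' : bundle_arc k m) :
  (forall s t, `[0, 1] s -> `[0, 1] t -> arc_curve r s <> arc_curve r' t) ->
  \forall n \near \oo, linked above
    (curve_turning n (arc_curve r)) (pos D (arc_src r)) (pos D (arc_tgt r))
    (curve_turning n (arc_curve r')) (pos D (arc_src r')) (pos D (arc_tgt r')).
Proof.
have ends x : (arc_curve x 0 = pos D (arc_src x) /\ arc_curve x 1 = pos D (arc_tgt x)) \/
    (arc_curve x 0 = pos D (arc_tgt x) /\ arc_curve x 1 = pos D (arc_src x)).
  have := curve_ends D (arc_ends_edge x); rewrite -/(arc_curve x) => eq_ends.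
  have /= := eq_ends; move/seteqP => [sub1 sub2].
  have [y0 y0x e0] := sub1 _ (or_introl erefl).
  have [y1 y1x e1] := sub1 _ (or_intror erefl).
  have y01 : y0 <> y1.
    move=> y01; have /eqP : (0 : R) = 1.
      have := @curve_simple _ _ D _ (arc_ends_edge x) 0 1.
      by rewrite !in_itv /= !lexx ler01 -/(arc_curve x) -e0 -e1 y01; apply.
    by rewrite eq_sym oner_eq0.
  move: y0x y1x; rewrite /= !inE => /orP[]/eqP y0E /orP[]/eqP y1E; subst; auto.
  - by [].
  - by [].
move=> disj; have c x := @curve_continuous _ _ D _ (arc_ends_edge x).
have := near_linked (arc_curve r) (arc_curve r') (c r) (c r') disj; apply: filterS => n.
case: (ends r) => -[-> ->]; case: (ends r') => -[-> ->] //.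
- exact: linked_swapr.
- exact: linked_swapl.
- by move=> h; apply/linked_swapl/linked_swapr.
Qed.


Lemma disjoint_paths_meet (c : 'I_k) (phi : 'I_10 -> option 'I_m) :
  exists r r' : bundle_arc k m, [/\ arc_path r = (c, r.2.1, phi r.2.1),
    arc_path r' = (c, r'.2.1, phi r'.2.1), K5_disjoint r.2.1 r'.2.1 &
    exists p, (arc_curve r @` `[0, 1]) p /\ (arc_curve r' @` `[0, 1]) p].
Proof.
apply: contrapT => nomeet.
pose on_path (r : bundle_arc k m) := arc_path r = (c, r.2.1, phi r.2.1).
(* There are finitely many pairs of arcs, so one mesh serves all of them. *)
have [n linkn] : exists n, forall x : bundle_arc k m * bundle_arc k m,
    on_path x.1 -> on_path x.2 -> K5_disjoint x.1.2.1 x.2.2.1 ->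
    linked above
      (curve_turning n (arc_curve x.1)) (pos D (arc_src x.1)) (pos D (arc_tgt x.1))
      (curve_turning n (arc_curve x.2)) (pos D (arc_src x.2)) (pos D (arc_tgt x.2)).
  suff /filter_ex : \forall n \near \oo, forall x : bundle_arc k m * bundle_arc k m,
    on_path x.1 -> on_path x.2 -> K5_disjoint x.1.2.1 x.2.2.1 ->
    linked above
      (curve_turning n (arc_curve x.1)) (pos D (arc_src x.1)) (pos D (arc_tgt x.1))
      (curve_turning n (arc_curve x.2)) (pos D (arc_src x.2)) (pos D (arc_tgt x.2)) by [].
  apply: filter_forall => -[r r'] /=.
  have [[p1 p2 p3]|np] := pselect [/\ on_path r, on_path r' & K5_disjoint r.2.1 r'.2.1].
    apply: filterS (near_linked_arcs r r' _) => // s t sI tI eq_st.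
    by apply: nomeet; exists r, r'; split => //; exists (arc_curve r s); split; [exists s|exists t].
  by apply: nearW => n p1 p2 p3; case: np.
pose P i := pos D (c, inl i).
(* The passing parity of a path of length two is the sum over its halves. *)
pose T e := match phi e with
  | None => curve_turning n (arc_curve (c, (e, None)))
  | Some a => fun v => curve_turning n (arc_curve (c, (e, Some (a, false)))) v (+)
                       curve_turning n (arc_curve (c, (e, Some (a, true)))) v
  end.
apply: (K5_not_linked (fun i j => above (P i) (P j)) (fun e i => T e (P i))).
  move=> i j ij; rewrite /above -[P i - P j]opprB upperN ?negbK // subr_eq0.
  by apply: contraNneq ij => /pos_inj [->].
move=> e f def.
suff : linked above (T e) (P (K5_src e)) (P (K5_tgt e)) (T f) (P (K5_src f)) (P (K5_tgt f)) by [].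
have link x y : on_path (c, (e, x)) -> on_path (c, (f, y)) -> _ :=
  fun px py => linkn ((c, (e, x)), (c, (f, y))) px py def.
rewrite /T; move: link; rewrite /on_path /arc_path /=.
case: (phi e) => [a|]; case: (phi f) => [b|] link.
- apply: linked_catl; [apply: linked_catr|apply: linked_catr].
  + exact: (link (Some (a, false)) (Some (b, false))).
  + exact: (link (Some (a, false)) (Some (b, true))).
  + exact: (link (Some (a, true)) (Some (b, false))).
  + exact: (link (Some (a, true)) (Some (b, true))).
- apply: linked_catl; first exact: (link (Some (a, false)) None).
  exact: (link (Some (a, true)) None).
- apply: linked_catr; first exact: (link None (Some (b, false))).
  exact: (link None (Some (b, true))).
- exact: (link None None).
Qed.

(** A third arc through [p] would, by [curve_triple], force a vertex common to the two disjoint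
    arcs. *)
Lemma arc_crossing_uniq (r1 r2 r3 r4 : bundle_arc k m) p :
  [disjoint arc_ends r1 & arc_ends r2]%B -> [disjoint arc_ends r3 & arc_ends r4]%B ->
  (arc_curve r1 @` `[0, 1]) p -> (arc_curve r2 @` `[0, 1]) p ->
  (arc_curve r3 @` `[0, 1]) p -> (arc_curve r4 @` `[0, 1]) p ->
  r3 = r1 /\ r4 = r2 \/ r3 = r2 /\ r4 = r1.
Proof.
have neq (r r' : bundle_arc k m) : [disjoint arc_ends r & arc_ends r']%B -> r != r'.
  apply: contraTneq => ->; rewrite -setI_eq0 finset.setIid; apply/set0Pn.
  by exists (arc_src r'); rewrite !inE eqxx.
move=> d12 d34 p1 p2 p3 p4.
have third r : (arc_curve r @` `[0, 1]) p -> r = r1 \/ r = r2.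
  move=> pr; have [-> |n1] := eqVneq r r1; first by left.
  have [-> |n2] := eqVneq r r2; first by right.
  have n12 := neq _ _ d12; rewrite eq_sym in n1; rewrite eq_sym in n2.
  rewrite -(inj_eq arc_ends_inj) in n12; rewrite -(inj_eq arc_ends_inj) in n1.
  rewrite -(inj_eq arc_ends_inj) in n2.
  have [v [v1 v2 _ _]] := @curve_triple _ _ D _ _ _ p
    (arc_ends_edge r1) (arc_ends_edge r2) (arc_ends_edge r) n12 n1 n2 p1 p2 pr.
  by have := disjointFr d12 v1; rewrite v2.
have := neq _ _ d34.
by case: (third _ p3) (third _ p4) => -> [] ->; rewrite ?eqxx; auto.
Qed.

Lemma bundled_crossings_lb l : (crossings D #= `I_l)%card -> (k * m.+1 ^ 2 <= l)%N.
Proof.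
rewrite card_eq_sym => /card_set_bijP[f [_ _ surj]].
pose O : finType := option 'I_m; pose C : finType := ('I_k * {ffun 'I_10 -> O})%type.
pose meets (q : nat) (x : C) (r r' : bundle_arc k m) :=
  [/\ arc_path r = (x.1, r.2.1, x.2 r.2.1), arc_path r' = (x.1, r'.2.1, x.2 r'.2.1),
    K5_disjoint r.2.1 r'.2.1, (arc_curve r @` `[0, 1]) (f q) &
    (arc_curve r' @` `[0, 1]) (f q)].
pose S q := [set x : C | `[< exists r r', meets q x r r' >]]%SET.
have disj q x r r' : meets q x r r' -> [disjoint arc_ends r & arc_ends r']%B.
  by case=> -[c1 _] [c2 _] def _ _; apply: arc_ends_disjoint; rewrite // c1 c2.
have cover : (#|C| <= \sum_(q < l) #|S q|)%N.
  rewrite -cardsT; apply: (@leq_trans #|(\bigcup_(q < l) S q)%SET|).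
    apply/subset_leq_card/fintype.subsetP => -[c phi] _.
    have [r [r' [pr pr' def [p [p1 p2]]]]] := disjoint_paths_meet c phi.
    have dis : [disjoint arc_ends r & arc_ends r']%B.
      by apply: arc_ends_disjoint => //; case: pr => -> _; case: pr' => -> _.
    have [q /= ql fq] : (f @` `I_l) p.
      apply: surj; exists (arc_ends r), (arc_ends r'); split; rewrite ?arc_ends_edge //.
        apply: contraTneq dis => ->; rewrite -setI_eq0 finset.setIid; apply/set0Pn.
        by exists (arc_src r'); rewrite !inE eqxx.
      by move=> [v [v1 v2 _]]; have := disjointFr dis v1; rewrite v2.
    apply/finset.bigcupP; exists (Ordinal ql) => //; rewrite inE; apply/asboolP.
    by exists r, r'; split; rewrite // fq.
  elim/big_rec2: _ => [|q A N _ le_A]; first by rewrite cards0.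
  by rewrite (leq_trans (leq_card_setU _ _)) // leq_add2l.
have cardO : #|O| = m.+1 by rewrite card_option card_ord.
(* The two arcs at crossing [q] are determined up to order, so all choices in [S q] share the copy
   and two of the ten paths. *)
have fiber q : (#|S q| * m.+1 ^ 2 <= m.+1 ^ 10)%N.
  have [->|[[c phi]]] := set_0Vmem (S q); first by rewrite cards0.
  rewrite inE => /asboolP[r [r' mrr']]; have [[ec er] [ec' er'] def p1 p2] := mrr'.
  have neq_rr' : r.2.1 != r'.2.1.
    by case/and4P: def => + _ _ _; apply: contraNneq => ->.
  suff : (#|S q| * m.+1 ^ 2 <= #|O| ^ #|'I_10|)%N by rewrite cardO card_ord.
  have := card_ffun_fix2 _ O r.2.1 r'.2.1 (phi r.2.1) (phi r'.2.1) neq_rr'.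
  set F := [set _ | _]%SET; rewrite cardO; apply: leq_trans.
  rewrite leq_mul2r; apply/orP; right.
  suff sub : S q \subset finset.setX [set c]%SET F.
    by rewrite (leq_trans (subset_leq_card sub)) // cardsX cards1 mul1n.
  apply/fintype.subsetP => -[c' psi].
  rewrite inE => /asboolP[r3 [r4 m34]]; rewrite !inE /=.
  have [[e1 e2] [e3 e4] _ q1 q2] := m34.
  have := arc_crossing_uniq r r' r3 r4 (f q) (disj _ _ _ _ mrr') (disj _ _ _ _ m34) p1 p2 q1 q2.
  rewrite /= in ec er ec' er' e1 e2 e3 e4.
  by move=> [[E3 E4]|[E3 E4]]; move: e1 e2 e3 e4; rewrite E3 E4 ec ?ec' er er'
    => -> -> _ ->; rewrite !eqxx.
have : (#|C| * m.+1 ^ 2 <= l * m.+1 ^ 10)%N.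
  apply: leq_trans (leq_mul cover (leqnn _)) _.
  rewrite big_distrl /= -[X in (X * _)%N]card_ord -sum_nat_const.
  exact: leq_sum.
rewrite card_prod card_ffun !card_ord cardO mulnAC leq_pmul2r // expn_gt0 //.
Qed.

End LowerBound.

(** * An optimal drawing *)

Section K5Layout.
Context {R : realType}.

(** The edges are far enough apart that thin bundles around them create no new kind of intersection.
    Edge 2 is vertical, edge 8 horizontal, and they cross at the origin. *)
Definition K5_point (i : nat) : R * R :=
  nth (0, 0) [:: (0, -24); (-24, 24); (24, 0); (0, 4); (-4, 0)] i.

(* Any small vector not parallel to the edge would do; edge 8 is horizontal. *)
Definition bulge (e : nat) : R * R := if e == 8%N then (0, 1) else (1, 0).

Definition bundle_point (e : 'I_10) (x g : R) : R * R :=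
  let s := K5_point (K5_src e) in let t := K5_point (K5_tgt e) in
  (s.1 + x * (t.1 - s.1) + g * (bulge e).1, s.2 + x * (t.2 - s.2) + g * (bulge e).2).

(* In the drawing of [K5] only the edges 2 (from vertex 0 to vertex 3) and 8
   (from vertex 2 to vertex 4) cross. *)
Definition crossing_pair (e f : nat) : bool :=
  ((e == 2%N) && (f == 8%N)) || ((e == 8%N) && (f == 2%N)).

(** The bounds on [g] confine a bundle to a thin triangle over its edge, pinched at the ends. All
    conditions are linear, so each of the 45 pairs of edges is settled by linear arithmetic. *)
Lemma bundles_meet_lt (e f : 'I_10) (x g y h : R) : (e < f)%N ->
  0 <= g -> g <= x -> g <= 1 - x -> 0 <= h -> h <= y -> h <= 1 - y ->
  bundle_point e x g = bundle_point f y h ->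
  [\/ K5_src e = K5_src f :> nat /\ x = 0 /\ y = 0,
      K5_src e = K5_tgt f :> nat /\ x = 0 /\ y = 1,
      K5_tgt e = K5_src f :> nat /\ x = 1 /\ y = 0 |
      K5_tgt e = K5_tgt f :> nat /\ x = 1 /\ y = 1] \/
  crossing_pair e f /\ (1/2 < x < 1) /\ (1/2 < y < 1).
Proof.
move=> + g0 gx gx1 h0 hy hy1; rewrite /bundle_point !K5_srcE !K5_tgtE.
case: e => [[|[|[|[|[|[|[|[|[|[|e]]]]]]]]]] le] //;
case: f => [[|[|[|[|[|[|[|[|[|[|f]]]]]]]]]] lf] //= _ [e1 e2];
first [ exfalso; lra
      | left; apply: Or41; split; [by []|split; lra]
      | left; apply: Or42; split; [by []|split; lra]
      | left; apply: Or43; split; [by []|split; lra]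
      | left; apply: Or44; split; [by []|split; lra]
      | right; split; [by []|split; apply/andP; split; lra] ].
Qed.

Lemma bundle_point_inj (e : 'I_10) (x g y h : R) :
  bundle_point e x g = bundle_point e y h -> x = y /\ g = h.
Proof.
rewrite /bundle_point !K5_srcE !K5_tgtE.
by case: e => [[|[|[|[|[|[|[|[|[|[|e]]]]]]]]]] le] //= [e1 e2]; split; lra.
Qed.

End K5Layout.

Section BundleLayout.
Local Open Scope classical_set_scope.
Context {R : realType}.

Definition end_param (e : 'I_10) (x : R) (i : 'I_5) :=
  (i = K5_src e /\ x = 0) \/ (i = K5_tgt e /\ x = 1).

Lemma crossing_pairC e f : crossing_pair e f = crossing_pair f e.
Proof. by rewrite /crossing_pair orbC; congr (_ || _); apply: andbC. Qed.

Lemma bundles_meet (e f : 'I_10) (x g y h : R) : e != f ->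
  0 <= g -> g <= x -> g <= 1 - x -> 0 <= h -> h <= y -> h <= 1 - y ->
  bundle_point e x g = bundle_point f y h ->
  (exists i, end_param e x i /\ end_param f y i) \/
  crossing_pair e f /\ (1/2 < x < 1) /\ (1/2 < y < 1).
Proof.
wlog lt_ef : e f x g y h / (e < f)%N.
  move=> H; rewrite -(inj_eq val_inj) neq_ltn => /orP[ef|fe] g0 gx gx1 h0 hy hy1.
    by apply: H; rewrite // -(inj_eq val_inj) neq_ltn ef.
  move/esym/H => []//; first by rewrite -(inj_eq val_inj) neq_ltn fe.
    by move=> [i [? ?]]; left; exists i.
  by move=> [? [? ?]]; right; rewrite crossing_pairC.
move=> _ g0 gx gx1 h0 hy hy1 /(bundles_meet_lt _ _ _ _ _ _ lt_ef g0 gx gx1 h0 hy hy1).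
move=> [|]; last by right.
case=> -[/val_inj eq_v [x0 y0]]; left.
- by exists (K5_src e); split; left.
- by exists (K5_src e); split; [left|right].
- by exists (K5_tgt e); split; [right|left].
- by exists (K5_tgt e); split; right.
Qed.

(** Copies are shifted horizontally by multiples of 100, so this keeps them apart. *)
Lemma bundle_point_bound e (x g : R) : 0 <= g -> g <= x -> g <= 1 - x ->
  -25 < (bundle_point e x g).1 < 25.
Proof.
rewrite /bundle_point !K5_srcE !K5_tgtE => g0 gx gx1.
by case: e => [[|[|[|[|[|[|[|[|[|[|e]]]]]]]]]] le] //=; apply/andP; split; lra.
Qed.

Context {k m : nat}.

(* The direct edge of a bundle is straight; the other paths bulge by distinct
   amounts, below 1. *)
Definition height (o : option 'I_m) : R :=
  if o is Some a then a.+1%:R / m.+1%:R else 0.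

Lemma height_bound o : 0 <= height o <= 1.
Proof.
case: o => [a|] /=; last by rewrite lexx ler01.
by rewrite divr_ge0 // ler_pdivrMr // mul1r ler_nat ltnS ltnW.
Qed.

Lemma height_inj : injective height.
Proof.
have pos (a : 'I_m) : a.+1%:R / m.+1%:R != 0 :> R by rewrite mulf_neq0 ?invr_eq0 ?pnatr_eq0.
move=> [a|] [b|] //=.
- move=> /(mulIf _) /eqP; rewrite invr_eq0 pnatr_eq0 => /(_ isT).
  by rewrite eqr_nat eqSS => /eqP/val_inj ->.
- by move/eqP; rewrite (negPf (pos a)).
- by move/esym/eqP; rewrite (negPf (pos b)).
Qed.

(* The middle vertex of a path sits at parameter [1 / 2], whereas the crossings
   are at parameters between [1 / 2] and [1]. *)
Definition path_point (c : 'I_k) (e : 'I_10) (o : option 'I_m) (x : R) : R * R :=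
  let p := bundle_point e x (height o * (x * (1 - x))) in (100 * c%:R + p.1, p.2).

(** As [height o] is at most 1, the parabolic arcs stay inside the triangles treated by
    [bundles_meet]. *)
Lemma height_mul_bound o (x : R) : 0 <= x <= 1 ->
  [/\ 0 <= height o * (x * (1 - x)), height o * (x * (1 - x)) <= x &
      height o * (x * (1 - x)) <= 1 - x].
Proof.
move=> /andP[x0 x1]; have /andP[h0 h1] := height_bound o.
move: (height o) h0 h1 => h h0 h1.
have p0 : 0 <= x * (1 - x) by rewrite mulr_ge0 // subr_ge0.
have p1 : h * (x * (1 - x)) <= x * (1 - x) by rewrite ler_piMl.
have p2 : x * (1 - x) = x - x * x by ring.
have p3 : 1 - x - x * (1 - x) = (1 - x) * (1 - x) by ring.
have p4 : 0 <= (1 - x) * (1 - x) by rewrite mulr_ge0 // subr_ge0.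
have p5 : 0 <= x * x by rewrite mulr_ge0.
by split; [exact: mulr_ge0 | lra | lra].
Qed.

Lemma path_points_meet c c' e e' o o' (x x' : R) : 0 <= x <= 1 -> 0 <= x' <= 1 ->
  path_point c e o x = path_point c' e' o' x' ->
  c = c' /\ [\/ [/\ e = e', x = x' & o = o' \/ x = 0 \/ x = 1],
    exists i, end_param e x i /\ end_param e' x' i |
    crossing_pair e e' /\ (1/2 < x < 1) /\ (1/2 < x' < 1)].
Proof.
move=> hx hx'.
have [g0 gx gx1] := height_mul_bound o x hx; have [h0 hx0 hx1] := height_mul_bound o' x' hx'.
have /andP[b1 b2] := bundle_point_bound e _ _ g0 gx gx1.
have /andP[b1' b2'] := bundle_point_bound e' _ _ h0 hx0 hx1.
rewrite /path_point; set p := bundle_point e _ _ in b1 b2 *.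
set q := bundle_point e' _ _ in b1' b2' *; move=> eqp.
have eq1 : 100 * c%:R + p.1 = 100 * c'%:R + q.1 := congr1 fst eqp.
have eq2 : p.2 = q.2 := congr1 snd eqp.
have eqc : c = c'.
  apply/eqP; rewrite -(inj_eq val_inj) eqn_leq; apply/andP; split; rewrite leqNgt;
  by apply/negP; rewrite -(ler_nat R) -natr1 /= => ?; lra.
split => //; subst c'.
have eq_p : p = q by apply: injective_projections => //; lra.
have [ee|ne] := eqVneq e e'; last first.
  by have [h|h] := bundles_meet _ _ _ _ _ _ ne g0 gx gx1 h0 hx0 hx1 eq_p;
     [apply: Or32 | apply: Or33].
subst e'; have [xx] := bundle_point_inj _ _ _ _ _ eq_p; subst x'.
move=> hh; apply: Or31; split => //.
have [->|x0] := eqVneq x 0; first by right; left.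
have [->|x1] := eqVneq x 1; first by right; right.
left; apply: height_inj; apply: mulIf hh.
by rewrite mulf_neq0 // subr_eq0 eq_sym.
Qed.

(** Edge 2 is vertical and edge 8 horizontal, each of length 28. Subtracting the equations of two
    meeting points shows that [784 + A * B] annihilates [x - x'], where 784 is the square of 28 and
    [A * B] is at most 1 in absolute value. *)
Lemma crossing_pair_meet_uniq c (e f : 'I_10) o o' (x y x' y' : R) :
  e = 2%N :> nat -> f = 8%N :> nat ->
  0 <= x <= 1 -> 0 <= y <= 1 -> 0 <= x' <= 1 -> 0 <= y' <= 1 ->
  path_point c e o x = path_point c f o' y ->
  path_point c e o x' = path_point c f o' y' -> x = x'.
Proof.
move=> e2 f8 hx hy hx' hy'.
rewrite /path_point /bundle_point !K5_srcE !K5_tgtE e2 f8 /= => -[p1 p2] [q1 q2].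
have /andP[h0 h1] := height_bound o; have /andP[h0' h1'] := height_bound o'.
move: (height o) (height o') h0 h1 h0' h1' p1 p2 q1 q2 => h h' h0 h1 h0' h1' p1 p2 q1 q2.
set A := h * (1 - x - x'); set B := h' * (1 - y - y').
have dy : A * (x - x') = -28 * (y - y') by rewrite /A; lra.
have dx : 28 * (x - x') = B * (y - y') by rewrite /B; lra.
have prod : (784 + A * B) * (x - x') = 0.
  by have : B * (A * (x - x')) = B * (-28 * (y - y')) by [rewrite dy|]; lra.
have bound u a b : 0 <= u <= 1 -> 0 <= a <= 1 -> 0 <= b <= 1 -> `|u * (1 - a - b)| <= 1 :> R.
  move=> /andP[u0 u1] /andP[a0 a1] /andP[b0 b1].
  rewrite normrM (ger0_norm u0) -[leRHS]mulr1 ler_pM //.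
  by rewrite ler_norml; apply/andP; split; lra.
move/eqP: prod; rewrite mulf_eq0 => /orP[/eqP eq0|]; last by rewrite subr_eq0 => /eqP.
have : `|A * B| <= 1.
  by rewrite normrM -[leRHS]mulr1 ler_pM // bound ?h0 ?h0'.
by rewrite ler_norml => /andP[+ _]; lra.
Qed.

End BundleLayout.

(** * Arcs of the drawing and the points where they meet *)

Section ArcLayout.
Local Open Scope classical_set_scope.
Context {R : realType} {k m : nat}.
Implicit Types (r : bundle_arc k m) (v : bundled_K5 k m).

(** The halves of a path of length two are one parabola cut at parameter [1 / 2]. *)
Definition arc_lo r : R := if r.2.2 is Some (_, true) then 1/2 else 0.
Definition arc_hi r : R := if r.2.2 is Some (_, false) then 1/2 else 1.
Definition arc_param r (t : R) := arc_lo r + t * (arc_hi r - arc_lo r).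
Definition arc_point r (t : R) : R * R :=
  path_point r.1 r.2.1 (omap fst r.2.2) (arc_param r t).

Definition vertex_point v : R * R :=
  match v.2 with
  | inl i => (100 * v.1%:R + (K5_point i).1, (K5_point i).2)
  | inr (e, a) => path_point v.1 e (Some a) (1/2)
  end.

Definition arc_end r (t : R) v := (t = 0 /\ v = arc_src r) \/ (t = 1 /\ v = arc_tgt r).

Lemma path_point0 c e (o : option 'I_m) :
  path_point c e o 0 = vertex_point (c : 'I_k, inl (K5_src e)).
Proof.
rewrite /path_point /bundle_point /vertex_point /=.
by congr (_, _); rewrite !(mul0r, mulr0, addr0).
Qed.

Lemma path_point1 c e (o : option 'I_m) :
  path_point c e o 1 = vertex_point (c : 'I_k, inl (K5_tgt e)).
Proof.
rewrite /path_point /bundle_point /vertex_point /= subrr !mulr0 !mul0r !addr0 !mul1r.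
by rewrite !(addrC _ (_ - _)) !subrK.
Qed.

Lemma arc_endP r t v : arc_end r t v -> arc_point r t = vertex_point v.
Proof.
rewrite /arc_end /arc_point /arc_param => -[[-> ->]|[-> ->]];
  rewrite ?mul0r ?addr0 ?mul1r 1?(addrC (arc_lo r)) ?subrK;
  case: r => c [e [[a []]|]]; rewrite /arc_lo /arc_hi /arc_src /arc_tgt /=;
  by rewrite ?path_point0 ?path_point1.
Qed.

Lemma arc_end_mem r t v : arc_end r t v -> v \in arc_ends r.
Proof. by case=> -[_ ->]; rewrite !inE eqxx ?orbT. Qed.

Lemma arc_end_uniq r t v w : arc_end r t v -> arc_end r t w -> v = w.
Proof.
move=> [[-> ->]|[-> ->]] [[h ->]|[h ->]] //; move/eqP: h.
  by rewrite eq_sym oner_eq0.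
by rewrite oner_eq0.
Qed.

Lemma arc_end_exists v : exists r t, 0 <= t <= 1 /\ arc_end r t v.
Proof.
case: v => c [i|[e a]]; last first.
  by exists (c, (e, Some (a, false))), 1; rewrite lexx ler01; split => //; right.
(* Vertex 0 is never a target, so it is taken as the source of the edge to vertex 4; any other
   vertex is the target of an edge from 0. *)
have [i0|i0] := posnP i.
  have [e [es et]] : exists e, K5_src e = i /\ K5_tgt e = inord 4.
    by apply: K5_complete; rewrite inordK // i0.
  by exists (c, (e, None)), 0; rewrite lexx ler01; split => //; left; rewrite /arc_src /= es.
have [e [es et]] := @K5_complete ord0 i i0.
by exists (c, (e, None)), 1; rewrite lexx ler01; split => //; right; rewrite /arc_tgt /= et.
Qed.

Lemma arc_param_bound r t : 0 <= t <= 1 -> 0 <= arc_param r t <= 1.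
Proof.
case: r => c [e [[a []]|]]; rewrite /arc_param /arc_lo /arc_hi /= => /andP[t0 t1];
by apply/andP; split; lra.
Qed.

Lemma arc_param_inj r t t' : arc_param r t = arc_param r t' -> t = t'.
Proof. by case: r => c [e [[a []]|]]; rewrite /arc_param /arc_lo /arc_hi /=; lra. Qed.

Lemma arc_param_end r t i : 0 <= t <= 1 -> end_param r.2.1 (arc_param r t) i ->
  arc_end r t (r.1, inl i).
Proof.
rewrite /end_param /arc_end; case: r => c [e [[a []]|]];
rewrite /arc_param /arc_lo /arc_hi /arc_src /arc_tgt /= => /andP[t0 t1] -[[-> h]|[-> h]];
by [exfalso; lra | left; split => //; lra | right; split => //; lra].
Qed.

Lemma arc_points_meet r r' t t' : 0 <= t <= 1 -> 0 <= t' <= 1 ->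
  arc_point r t = arc_point r' t' ->
  [\/ r = r' /\ t = t', exists v, arc_end r t v /\ arc_end r' t' v |
      [/\ r.1 = r'.1, crossing_pair r.2.1 r'.2.1, 1/2 < arc_param r t < 1 &
          1/2 < arc_param r' t' < 1]].
Proof.
move=> ht ht' /path_points_meet-/(_ (arc_param_bound _ _ ht) (arc_param_bound _ _ ht')).
move=> [eqc [[eqe eqx eqo]|[i [i1 i2]]|[cp [h1 h2]]]]; last 2 first.
- apply: Or32; exists (r.1, inl i); split; first exact: arc_param_end.
  by rewrite eqc; apply: arc_param_end.
- by apply: Or33.
have end_case i : end_param r.2.1 (arc_param r t) i ->
    exists v, arc_end r t v /\ arc_end r' t' v.
  move=> i1; exists (r.1, inl i); split; first exact: arc_param_end.
  by rewrite eqc; apply: arc_param_end => //; rewrite -eqx -eqe.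
case: eqo => [eqo|[x0|x1]]; last 2 first.
- by apply: Or32; apply: (end_case (K5_src r.2.1)); left.
- by apply: Or32; apply: (end_case (K5_tgt r.2.1)); right.
have [eqr|ner] := eqVneq r r'.
  by subst r'; apply: Or31; split => //; apply: arc_param_inj eqx.
(* Two distinct arcs of one path with a common parameter are its two halves, meeting at the middle
   vertex. *)
apply: Or32; move: ht ht' eqc eqe eqx eqo ner {end_case}.
rewrite /arc_end; case: r r' => c [e [[a b]|]] [c' [e' [[a' b']|]]] //=; last first.
  by move=> _ _ -> -> _ _; rewrite eqxx.
move=> /andP[t0 t1] /andP[t0' t1'] eqc eqe + [eqa]; subst c' e' a'.
rewrite /arc_param /arc_lo /arc_hi /arc_src /arc_tgt /=.
case: b b' => -[] /= eqx; rewrite ?eqxx // => _; exists (c, inr (e, a)).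
- by split; [left|right]; split => //; lra.
- by split; [right|left]; split => //; lra.
Qed.

(** Ends of arcs have parameter 0, [1 / 2] or 1, while crossings lie strictly between [1 / 2] and 1;
    so no vertex sits on a crossing. *)
Lemma arc_end_not_crossing r t v : arc_end r t v -> ~ (1/2 < arc_param r t < 1).
Proof.
move=> [[-> _]|[-> _]]; case: r => c [e [[a []]|]];
rewrite /arc_param /arc_lo /arc_hi /= => /andP[]; lra.
Qed.

Lemma vertex_on_arc r t v : 0 <= t <= 1 -> arc_point r t = vertex_point v -> arc_end r t v.
Proof.
move=> ht; have [r' [t' [ht' end_v]]] := arc_end_exists v.
rewrite -(arc_endP _ _ _ end_v) => /arc_points_meet-/(_ ht ht')[[-> ->]//|[w [w1 w2]]|[_ _ _]].
  by rewrite (arc_end_uniq _ _ _ _ end_v w2).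
by move/(arc_end_not_crossing _ _ _ end_v).
Qed.

Lemma vertex_point_inj : injective vertex_point.
Proof.
move=> v w; have [r [t [ht end_v]]] := arc_end_exists v.
rewrite -(arc_endP _ _ _ end_v) => /(vertex_on_arc _ _ _ ht).
exact: arc_end_uniq end_v.
Qed.

Lemma continuous_pair (f g : R -> R) : continuous f -> continuous g ->
  continuous (fun t => (f t, g t)).
Proof.
move=> cf cg t; apply: (@cvg_pair _ _ _ _ (nbhs (f t)) (nbhs (g t))).
  exact: cf.
exact: cg.
Qed.

Lemma continuous_quadratic (a b c lo w : R) : continuous (fun t : R =>
  a + (lo + t * w) * b + c * ((lo + t * w) * (1 - (lo + t * w)))).
Proof.
have lin : continuous (fun t : R => lo + t * w).
  by move=> t; apply: cvgD; [exact: cvg_cst | apply: cvgM; [exact: cvg_id | exact: cvg_cst]].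
move=> t; apply: cvgD; first apply: cvgD; try exact: cvg_cst.
  by apply: cvgM; [exact: lin | exact: cvg_cst].
apply: cvgM; first exact: cvg_cst.
by apply: cvgM; [exact: lin | apply: cvgB; [exact: cvg_cst | exact: lin]].
Qed.

Lemma continuous_arc_point r : continuous (arc_point r).
Proof.
pose e := r.2.1; pose h : R := height (omap fst r.2.2).
pose s : R * R := K5_point (K5_src e); pose p : R * R := K5_point (K5_tgt e).
have -> : arc_point r = fun t : R =>
  ((100 * r.1%:R + s.1) + arc_param r t * (p.1 - s.1) +
     (h * (bulge e).1) * (arc_param r t * (1 - arc_param r t)),
   s.2 + arc_param r t * (p.2 - s.2) +
     (h * (bulge e).2) * (arc_param r t * (1 - arc_param r t))).
  apply/funext => t; rewrite /arc_point /path_point /bundle_point -/e -/h -/s -/p /=.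
  by congr (_, _); ring.
by apply: continuous_pair; exact: continuous_quadratic.
Qed.

(** [arc_ends] is injective, so an edge determines its arc; the constant is a default for sets that
    are not edges. *)
Definition layout_curve (S : {set bundled_K5 k m}) : R -> R * R :=
  if [pick r | arc_ends r == S] is Some r then arc_point r else cst 0.

Lemma layout_curveE r : layout_curve (arc_ends r) = arc_point r.
Proof.
rewrite /layout_curve; case: pickP => [r' /eqP/arc_ends_inj -> //|].
by move/(_ r); rewrite eqxx.
Qed.

End ArcLayout.

Lemma card_le_setT_II (T : finType) : ([set: T] #<= `I_#|T|)%card.
Proof.
rewrite (card_le_eqr card_II).
apply: card_le_trans (card_image_le enum_val [set: 'I_#|T|]).
by apply: subset_card_le => x _; exists (enum_rank x); rewrite ?enum_rankK.
Qed.

(** * The drawing and its number of crossings *)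

Section Layout.
Local Open Scope classical_set_scope.
Context {R : realType} {k m : nat}.
Local Notation G := (bundled_K5 k m).
Implicit Types (r : bundle_arc k m) (S : {set G}).

Lemma layout_curve_arcP r p :
  (layout_curve (arc_ends r) @` `[0, 1]) p <->
  exists2 t : R, 0 <= t <= 1 & arc_point r t = p.
Proof.
rewrite layout_curveE; split=> -[t] /=; rewrite ?in_itv /= => ht <-;
by exists t; rewrite //= ?in_itv.
Qed.

Lemma layout_continuous S : S \in edges G ->
  {within `[0, 1], continuous (layout_curve S : R -> R * R)}.
Proof.
move=> /edges_bundledP[r ->]; rewrite layout_curveE.
exact/continuous_subspaceT/continuous_arc_point.
Qed.

Lemma layout_simple S : S \in edges G ->
  {in `[0, 1]%R &, injective (layout_curve S : R -> R * R)}.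
Proof.
move=> /edges_bundledP[r ->] s t; rewrite !in_itv /= layout_curveE => hs ht eq_st.
have [[_ //]|[v [vs vt]]|[_ + _ _]] := arc_points_meet _ _ _ _ hs ht eq_st.
  have := arc_src_neq_tgt r.
  by case: vs vt => -[-> ->] [] [-> // ->]; rewrite eqxx.
by rewrite /crossing_pair => /orP[] /andP[/eqP ->].
Qed.

Lemma layout_ends S : S \in edges G ->
  [set layout_curve S 0; layout_curve S 1] = (vertex_point : G -> R * R) @` [set` S].
Proof.
move=> /edges_bundledP[r ->]; rewrite layout_curveE.
rewrite (arc_endP r 0 (arc_src r)); last by left.
rewrite (arc_endP r 1 (arc_tgt r)); last by right.
apply/seteqP; split=> p /=.
  by move=> [->|->]; [exists (arc_src r)|exists (arc_tgt r)]; rewrite //= !inE eqxx ?orbT.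
by move=> [v]; rewrite !inE => /orP[]/eqP -> <-; [left|right].
Qed.

Lemma layout_vertex S v : S \in edges G ->
  (layout_curve S @` `[0, 1]) (vertex_point v : R * R) -> v \in S.
Proof.
move=> /edges_bundledP[r ->] /layout_curve_arcP[t ht /(vertex_on_arc _ _ _ ht)].
exact: arc_end_mem.
Qed.

Lemma layout_arcs_meet r r' (p : R * R) : r != r' ->
  (layout_curve (arc_ends r) @` `[0, 1]) p -> (layout_curve (arc_ends r') @` `[0, 1]) p ->
  (exists v, [/\ v \in arc_ends r, v \in arc_ends r' & p = vertex_point v]) \/
  r.1 = r'.1 /\ crossing_pair r.2.1 r'.2.1.
Proof.
move=> ner /layout_curve_arcP[t ht <-] /layout_curve_arcP[t' ht' /esym eq_p].
have [[eqr]|[v [v1 v2]]|[eqc cp _ _]] := arc_points_meet _ _ _ _ ht ht' eq_p.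
- by rewrite eqr eqxx in ner.
- left; exists v; split; [exact: arc_end_mem v1|exact: arc_end_mem v2|exact: arc_endP].
- by right.
Qed.

(** If two arcs meet at a vertex, [layout_vertex] puts it on the third. Otherwise three edges of
    [K5] would cross pairwise, but only edges 2 and 8 cross. *)
Lemma layout_triple S1 S2 S3 p : S1 \in edges G -> S2 \in edges G -> S3 \in edges G ->
  S1 != S2 -> S1 != S3 -> S2 != S3 ->
  (layout_curve S1 @` `[0, 1]) p -> (layout_curve S2 @` `[0, 1]) p ->
  (layout_curve S3 @` `[0, 1]) p ->
  exists v, [/\ v \in S1, v \in S2, v \in S3 & p = vertex_point v :> R * R].
Proof.
move=> e1 e2 e3; have := (e1, e2, e3).
move: e1 e2 e3 => /edges_bundledP[r1 ->] /edges_bundledP[r2 ->] /edges_bundledP[r3 ->].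
rewrite !(inj_eq arc_ends_inj) => -[[e1 e2] e3] n12 n13 n23 p1 p2 p3.
have [[v [v1 v2 pv]]|[_ c12]] := layout_arcs_meet _ _ _ n12 p1 p2.
  by exists v; split; rewrite // (layout_vertex _ v e3) // -pv.
have [[v [v1 v3 pv]]|[_ c13]] := layout_arcs_meet _ _ _ n13 p1 p3.
  by exists v; split; rewrite // (layout_vertex _ v e2) // -pv.
have [[v [v2 v3 pv]]|[_ c23]] := layout_arcs_meet _ _ _ n23 p2 p3.
  by exists v; split; rewrite // (layout_vertex _ v e1) // -pv.
move: c12 c13 c23; rewrite /crossing_pair.
by case/orP => /andP[/eqP-> /eqP->] /=; rewrite ?orbF => /eqP->.
Qed.

Definition layout : drawing R G :=
  @Drawing R G vertex_point layout_curve vertex_point_inj layout_continuous layout_simple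
    layout_ends layout_vertex layout_triple.

(** A crossing determines the copy and one path in each of the bundles 2 and 8, and by
    [crossing_pair_meet_uniq] two such paths meet at most once. *)
Lemma layout_crossings_ub : (crossings layout #<= [set: 'I_k * (option 'I_m * option 'I_m)])%card.
Proof.
pose on_bundle (x : 'I_k * (option 'I_m * option 'I_m)) (p : R * R) :=
  exists s t : R, [/\ 0 <= s <= 1, 0 <= t <= 1,
    p = path_point x.1 (inord 2) x.2.1 s & p = path_point x.1 (inord 8) x.2.2 t].
(* The default 0 is taken only for pairs of paths that do not meet. *)
pose g x := xget 0 (on_bundle x).
apply: card_le_trans (card_image_le g _); apply: subset_card_le.
move=> p [S [S' [/edges_bundledP[r ->] /edges_bundledP[r' ->]]]].
rewrite (inj_eq arc_ends_inj) => ner [/= pr pr'] nov.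
have [//|[eqc cp]] := layout_arcs_meet _ _ _ ner pr pr'.
have {ner nov cp} [x xp] : exists x, on_bundle x p.
  move: pr pr' => /layout_curve_arcP[s hs ps] /layout_curve_arcP[t ht pt].
  have hs' := arc_param_bound r _ hs; have ht' := arc_param_bound r' _ ht.
  case/orP: cp => /andP[/eqP e1 /eqP e2].
    exists (r.1, (omap fst r.2.2, omap fst r'.2.2)), (arc_param r s), (arc_param r' t).
    have <- : r.2.1 = inord 2 by apply: val_inj; rewrite /= e1 inordK.
    have <- : r'.2.1 = inord 8 by apply: val_inj; rewrite /= e2 inordK.
    by split=> //=; rewrite eqc.
  exists (r.1, (omap fst r'.2.2, omap fst r.2.2)), (arc_param r' t), (arc_param r s).
  have <- : r.2.1 = inord 8 by apply: val_inj; rewrite /= e1 inordK.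
  have <- : r'.2.1 = inord 2 by apply: val_inj; rewrite /= e2 inordK.
  by split=> //=; rewrite eqc.
exists x => //; rewrite /g; case: xgetP => [q -> xq|/(_ p)//].
move: xp xq => [s [t [hs ht -> ps']]] [s' [t' [hs' ht' -> qs']]].
rewrite (crossing_pair_meet_uniq _ _ _ _ _ _ _ _ _ _ _ hs ht hs' ht' ps' qs') //;
by rewrite inordK.
Qed.

Lemma crossing_number_bundled_K5 : crossing_number R G = (k * m.+1 ^ 2)%N.
Proof.
(* [drawable_with] asks for an exact count, so finiteness comes first; the two bounds then force
   equality. *)
have [l Dl] : exists l, (crossings layout #= `I_l)%card.
  apply/finite_setP; apply: card_le_finite layout_crossings_ub _.
  exact: finite_finset.
have lb l' : drawable_with R G l' -> (k * m.+1 ^ 2 <= l')%N.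
  by case=> D; exact: bundled_crossings_lb.
have draw : drawable_with R G (k * m.+1 ^ 2).
  exists layout; suff -> : (k * m.+1 ^ 2 = l)%N by [].
  apply/eqP; rewrite eqn_leq lb /=; last by exists layout.
  rewrite -card_le_II -(card_le_eql Dl).
  apply: card_le_trans layout_crossings_ub _.
  apply: card_le_trans (card_le_setT_II _) _.
  by rewrite card_le_II !card_prod !card_option !card_ord.
rewrite /crossing_number; case: xgetP => [l' -> [Dl' minl']|/(_ (k * m.+1 ^ 2)%N)[]//].
by apply/eqP; rewrite eqn_leq minl' // lb.
Qed.

End Layout.

(** * Chordality, minors, degrees *)

(** The two neighbours of [x] on the cycle are distinct and adjacent, hence consecutive as the cycle
    is induced, and the cycle closes up as a triangle. *)
Lemma induced_cycle_simplicial (G : sgraph) (c : seq G) (x : G) :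
  induced_cycle c -> x \in c ->
  (forall y z, y \in c -> z \in c -> adj x y -> adj x z -> y != z -> adj y z) ->
  size c = 3%N.
Proof.
move=> [sz /andP[cyc unq] ind] xc simp.
have [i s def_s] := rot_to xc.
have {}ind y z : y \in x :: s -> z \in x :: s -> adj y z ->
    z = next (x :: s) y \/ y = next (x :: s) z.
  by rewrite -def_s !mem_rot !next_rot //; apply: ind.
have {}simp y z : y \in x :: s -> z \in x :: s -> adj x y -> adj x z -> y != z -> adj y z.
  by rewrite -def_s !mem_rot; apply: simp.
have {}unq : uniq (x :: s) by rewrite -def_s rot_uniq.
have {}cyc : cycle (@adj G) (x :: s) by rewrite -def_s rot_cycle.
move: sz; rewrite -(size_rot i) {i}def_s.
case: s ind simp cyc unq => [|y [|z t]] // ind simp cyc unq _.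
move: (cyc) (unq) => /= /and3P[xy yz path_t] /and4P[xNs yNs zNt uniq_t].
have last_in : last z t \in z :: t by apply: mem_last.
have x_last : adj x (last z t).
  by move: path_t; rewrite rcons_path => /andP[_]; rewrite adj_sym.
have y_last : y != last z t by apply: contraNneq yNs => ->.
have y_in : y \in [:: x, y, z & t] by rewrite !inE eqxx orbT.
have l_in : last z t \in [:: x, y, z & t] by rewrite 2!in_cons last_in !orbT.
have next_l : next [:: x, y, z & t] (last z t) = x.
  rewrite next_nth l_in -[last z t]/(last x [:: y, z & t]) index_last //.
  by rewrite nth_default.
have next_y : next [:: x, y, z & t] y = z.
  by rewrite /= eqxx ifN //; apply: contraNneq xNs => ->; rewrite mem_head.
have [] := ind _ _ y_in l_in (simp _ _ y_in l_in xy x_last y_last).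
  rewrite next_y; clear -zNt; case: t zNt => //= u t.
  by move=> + l_z; rewrite -[X in X \notin _]l_z mem_last.
by rewrite next_l => yx; move: xNs; rewrite yx mem_head.
Qed.

Section BundledK5Properties.
Context {k m : nat}.
Local Notation G := (bundled_K5 k m).

(** The neighbours of a middle vertex are the ends of an edge of [K5], hence adjacent; a cycle
    without middle vertices lies in one clique, where any vertex will do. *)
Lemma chordal_bundled_K5 : chordal G.
Proof.
move=> c indc.
have nbr (x y z : G) i j : y.2 = inl i -> z.2 = inl j -> adj x y -> adj x z -> y != z -> adj y z.
  case: x y z => cx u [cy v] [cz w] /= -> ->; rewrite /= /bundled_adj /=.
  move=> /andP[/eqP <- _] /andP[/eqP <- _].
  by rewrite !xpair_eqE eqxx.
have [[x xc [p xp]]|noinr] := pselect (exists2 x : G, x \in c & exists p, x.2 = inr p).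
  apply: (induced_cycle_simplicial G c x indc xc) => y z yc zc xy xz.
  have inl_nbr w : adj x w -> exists i, w.2 = inl i.
    by rewrite /= /bundled_adj xp; case: w.2 => [i|q]; [exists i | rewrite andbF].
  have [[i Ey] [j Ez]] := (inl_nbr y xy, inl_nbr z xz).
  exact: (nbr x y z _ _ Ey Ez xy xz).
have [x xc] : exists x, x \in c.
  by case: indc; case: c {noinr} => // x c _ _ _; exists x; rewrite inE eqxx.
apply: (induced_cycle_simplicial G c x indc xc) => y z yc zc xy xz.
case Ey: y.2 => [i|q]; last by case: noinr; exists y => //; exists q.
case Ez: z.2 => [j|q]; last by case: noinr; exists z => //; exists q.
exact: (nbr x y z _ _ Ey Ez xy xz).
Qed.

(** [K33] is connected, so its branch sets lie in one copy. A branch set without a vertex of [K5] is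
    a single middle vertex, with only two neighbours where three are needed. So six disjoint branch
    sets would each contain one of five vertices. *)
Lemma bundled_K5_minor_free : minor_free K33 G.
Proof.
move=> [phi [phi0 conn dis edge]].
have eq_copy h x y : x \in phi h -> y \in phi h -> x.1 = y.1.
  move=> xh yh; have /connectP[p] := conn h x y xh yh.
  elim: p x {xh} => [|u p IH] x /=; first by move=> _ ->.
  by move=> /andP[/and3P[_ _ /andP[/eqP -> _]] pth] /(IH _ pth).
have adj_copy h k' x y : adj h k' -> x \in phi h -> y \in phi k' -> x.1 = y.1.
  move=> /edge[u [v [uh vk /andP[/eqP uv _]]]] xh yk.
  by rewrite (eq_copy h x u) // uv (eq_copy k' y v).
have inj_phi h k' x : x \in phi h -> x \in phi k' -> h = k'.
  move=> xh xk; apply: contraTeq xk => /dis/disjointFr => /(_ _ xh) ->.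
  by [].
have branch h : exists ci : 'I_k * 'I_5, (ci.1, inl ci.2) \in phi h.
  apply: contrapT => noinl.
  have [x xh] := set0Pn _ (phi0 h).
  case: x xh => c [i|[e a]] xh; first by apply: noinl; exists (c, i).
  have single y : y \in phi h -> y = (c, inr (e, a)).
    move=> yh; have /connectP[[_ //|u p] /= /andP[/and3P[_ uh au] _] _] := conn h _ _ xh yh.
    case: u uh au => c' [i|q] uh; last by rewrite /= /bundled_adj andbF.
    by case: noinl; exists (c', i).
  pose nb (j : 'I_3) : K33 := (~~ h.1, j).
  have nbP j : exists i, (c, inl i) \in phi (nb j) /\ K5_incident e i.
    have adj_nb : adj h (nb j) by rewrite /= /K33_adj /=; case: h.1.
    have [x' [y' [x'h y'n]]] := edge h (nb j) adj_nb; rewrite (single _ x'h).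
    by case: y' y'n => c' [i|q] y'n /= /andP[/eqP /= cc inc] //; exists i; rewrite cc.
  have [f fP] := choice nbP.
  have f_inj : injective f.
    move=> j j' eq_f; have [+ _] := fP j; have [+ _] := fP j'; rewrite eq_f => h1 h2.
    by have [] := inj_phi _ _ _ h2 h1.
  have : (#|'I_3| <= #|[set K5_src e; K5_tgt e]%SET|)%N.
    rewrite -cardsT -(card_imset _ f_inj); apply/subset_leq_card/fintype.subsetP.
    by move=> _ /imsetP[j _ ->]; rewrite !inE; have [_] := fP j.
  by rewrite card_ord cards2; case: (_ != _).
have [f fP] := choice branch.
have same h k' : (f h).1 = (f k').1.
  have adjne (h1 h2 : K33) : h1.1 != h2.1 -> (f h1).1 = (f h2).1.
    by move=> ne; exact: (adj_copy h1 h2 _ _ ne (fP h1) (fP h2)).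
  have [e|] := eqVneq h.1 k'.1; last exact: adjne.
  by rewrite (adjne h (~~ h.1, ord0)) ?(adjne k' (~~ h.1, ord0)) //= -?e; case: h.1.
have f_inj : injective (fun h => (f h).2).
  move=> h k' eq_f; apply: (inj_phi _ _ _ (fP h)).
  by rewrite (same h k') eq_f; exact: fP.
by have := leq_card _ f_inj; rewrite card_prod card_bool !card_ord.
Qed.

Lemma card_bundled_K5 : #|G| = (k * (5 + 10 * m))%N.
Proof. by rewrite card_prod card_sum card_prod !card_ord. Qed.

Lemma card_K5_incident (i : 'I_5) : #|[set e | K5_incident e i]%SET| = 4%N.
Proof.
rewrite -sum1_card big_mkcond /=.
rewrite (eq_bigr (fun e : 'I_10 =>
  if (i == nth 0 [:: 0; 0; 0; 0; 1; 1; 1; 2; 2; 3] e :> nat) ||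
     (i == nth 0 [:: 1; 2; 3; 4; 2; 3; 4; 3; 4; 4] e :> nat) then 1 else 0))%N; last first.
  by move=> e _; rewrite inE /K5_incident -!(inj_eq val_inj) /= K5_srcE K5_tgtE.
rewrite -(big_mkord xpredT (fun e : nat =>
  if (i == nth 0 [:: 0; 0; 0; 0; 1; 1; 1; 2; 2; 3] e :> nat) ||
     (i == nth 0 [:: 1; 2; 3; 4; 2; 3; 4; 3; 4; 4] e :> nat) then 1 else 0))%N.
rewrite unlock; by case: i => [[|[|[|[|[|i]]]]] ?].
Qed.

(** A vertex of [K5] has 4 neighbours in [K5] and [m] middle vertices on each of its 4 edges; a
    middle vertex has at most 2 neighbours. *)
Lemma max_degree_bundled_K5 : (0 < k)%N -> max_degree G = (4 * m.+1)%N.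
Proof.
move=> k0.
have deg_inl c i : #|[pred y : G | adj ((c, inl i) : G) y]| = (4 * m.+1)%N.
  pose A : {set G} := [set ((c, inl j) : G) | j in [set~ i]]%SET.
  pose B : {set G} :=
    [set ((c, inr p) : G) | p in finset.setX [set e | K5_incident e i] [set: 'I_m]]%SET.
  have -> : #|[pred y : G | adj ((c, inl i) : G) y]| = #|(A :|: B)%SET|.
    apply: eq_card => -[d [j|[e a]]]; rewrite !inE /= /bundled_adj /=.
      rewrite orbC; apply/andP/orP => [[/eqP <- ne]|[]]; last first.
      - by move=> /imsetP[j' + [-> ->]]; rewrite !inE eqxx eq_sym.
      - by move=> /imsetP[].
      by right; apply/imsetP; exists j; rewrite ?inE 1?eq_sym.
    apply/andP/orP => [[/eqP <- inc]|[]].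
    - by right; apply/imsetP; exists (e, a); rewrite ?inE ?inc.
    - by move=> /imsetP[].
    - by move=> /imsetP[[e' a'] + [-> -> _]]; rewrite !inE andbT eqxx.
  rewrite cardsU.
  have -> : (A :&: B = finset.set0)%SET.
    apply/setP => x; rewrite !inE; apply/negP => /andP[/imsetP[j _ ->] /imsetP[p _]] [].
    by [].
  rewrite cards0 subn0 card_imset ?card_imset; last 2 first.
  - by move=> ? ? [].
  - by move=> ? ? [].
  by rewrite cardsC1 cardsX card_K5_incident cardsT !card_ord mulnS.
have deg_inr c p : (#|[pred y : G | adj ((c, inr p) : G) y]| <= 2)%N.
  pose E : {set G} := [set (c, inl (K5_src p.1)); (c, inl (K5_tgt p.1))]%SET.
  apply: leq_trans (_ : #|E| <= 2)%N; last first.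
    by rewrite cards2; case: (_ != _).
  apply/subset_leq_card/fintype.subsetP => -[d [j|q]]; rewrite !inE /= /bundled_adj /= ?andbF //.
  by move=> /andP[/eqP <-] /orP[] /eqP ->; rewrite eqxx ?orbT.
apply/eqP; rewrite eqn_leq; apply/andP; split.
  apply/bigmax_leqP => -[c [i|p]] _; first by rewrite deg_inl.
  by rewrite (leq_trans (deg_inr c p)) // mulnS.
by rewrite -(deg_inl (Ordinal k0) ord0) /max_degree; apply: leq_bigmax.
Qed.

End BundledK5Properties.

Theorem lemma4 (R : realType) (Delta n : nat)
    (hDelta : (0 < Delta)%N) (hn : (0 < n)%N)
    (hDelta4 : Delta = 0 %[mod 4])
    (hn5 : n = 0 %[mod 5 * (Delta %/ 2 - 1)]) :
  exists G : sgraph,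
    [/\ chordal G, minor_free K33 G, #|G| = n, max_degree G = Delta &
      (crossing_number R G)%:R
        = Delta%:R * n%:R / 40 * (1 + 2 / (Delta%:R - 2)) :> R
      /\ (crossing_number R G)%:R > Delta%:R * n%:R / 40 :> R].
Proof.
have [m defD] : exists m, Delta = (4 * m.+1)%N.
  by exists (Delta %/ 4)%N.-1; move: hDelta4; rewrite mod0n; lia.
have [k defn] : exists k, n = (k * (5 + 10 * m))%N.
  (* With [Delta = 4 * m.+1] the modulus is the number of vertices of one copy. *)
  exists (n %/ (5 * (Delta %/ 2 - 1)))%N.
  have <- : (5 * (Delta %/ 2 - 1) = 5 + 10 * m)%N by lia.
  by rewrite divnK // /dvdn hn5 mod0n.
have k_gt0 : (0 < k)%N by move: hn; rewrite defn; case: (k).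
exists (bundled_K5 k m); split.
- exact: chordal_bundled_K5.
- exact: bundled_K5_minor_free.
- by rewrite card_bundled_K5.
- by rewrite max_degree_bundled_K5.
rewrite crossing_number_bundled_K5 defD defn.
rewrite !(natrM, natrX, natrD) -natr1.
have k0 : 0 < k%:R :> R by rewrite ltr0n.
have m0 : 0 <= m%:R :> R by rewrite ler0n.
move: (k%:R) (m%:R) k0 m0 => x y x0 y0.
have d0 : 4 * (y + 1) - 2 != 0 by apply/eqP; lra.
have -> : 4 * (y + 1) * (x * (5 + 10 * y)) / 40 * (1 + 2 / (4 * (y + 1) - 2)) =
  x * (y + 1) ^+ 2 by field.
split=> //; rewrite -subr_gt0.
have -> : x * (y + 1) ^+ 2 - 4 * (y + 1) * (x * (5 + 10 * y)) / 40 =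
  x * (y + 1) / 2 by field.
by rewrite divr_gt0 // mulr_gt0 //; lra.
Qed.
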